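(* Let $n\geq 1$ and let $f:GL_n(R)\rightarrow \mathfrak{gl}_n(R)$ be a $\delta$-map which is a cocycle for the adjoint action, i.e. for all $g_1,g_2\in GL_n(R)$, $$f(g_1g_2)=f(g_1)+g_1f(g_2)g_1^{-1}.$$ Then there exist a $\delta$-homomorphism $\omega:\mathbb{G}_m\rightarrow\mathbb{G}_a$ (i.e. a group homomorphism $\omega:R^{\times}\rightarrow R$ which is a $\delta$-map) and a matrix $v\in\mathfrak{gl}_n(R)$ such that for all $g\in GL_n(R)$, $$f(g)=\omega(\det(g))\,1_n+gvg^{-1}-v.$$
   Context: $\delta$-arithmetic setting: $p$ is an odd prime and $R$ is the unique complete discrete valuation ring with maximal ideal $pR$ and residue field $R/pR$ equal to the algebraic closure $\mathbb{F}_p^a$ of $\mathbb{F}_p$ (i.e. the Witt vectors of $\mathbb{F}_p^a$). Let $\phi:R\rightarrow R$ be the unique ring homomorphism lifting the $p$-power Frobenius of the residue field, and let $\delta:R\rightarrow R$ be $\delta x=(\phi(x)-x^p)/p$. For a tuple of variables $x$, write $\hat{\ }$ for $p$-adic completion. A map $f:R^N\rightarrow R^M$ is a $\delta$-map (of order $m$) if there is an $M$-tuple $F$ of restricted power series in $R[x_0,\dots,x_m]\hat{\ }$ ($x_i$ being $N$-tuples of variables) with $f(a)=F(a,\delta a,\dots,\delta^m a)$ for all $a\in R^N$ ($\delta$ applied componentwise). For $GL_n$, $\mathbb{G}_m$, etc., a $\delta$-map is a map of $R$-points of this form where the power series may also involve the inverse of the determinant (for $GL_n$) or $x^{-1}$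 (for $\mathbb{G}_m$), i.e. $F$ has entries in $R[x,\det(x)^{-1},x',\dots,x^{(m)}]\hat{\ }$ with $f(g)=F(g,\delta g,\dots,\delta^m g)$. $\mathfrak{gl}_n(R)$ denotes all $n\times n$ matrices over $R$ and $1_n$ the identity matrix. *)

(* Defs.v *)
From HB Require Import structures.
From mathcomp Require Import all_boot all_order all_algebra.
Set Implicit Arguments. Unset Strict Implicit. Unset Printing Implicit Defensive.
Import GRing.Theory.
Local Open Scope ring_scope.

Definition dvdr (R : comNzRingType) (a b : R) : Prop := exists r : R, b = a * r.

(** Characterization (up to isomorphism) of the setting of the paper:
    R is a complete discrete valuation ring with maximal ideal pR (p an odd
    prime), residue field R/pR = algebraic closure of F_p,
    phi : R -> R a ring endomorphism lifting Frobenius, and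
    delta x = (phi x - x^p)/p. *)
Definition delta_setting (R : idomainType) (p : nat)
    (phi : {rmorphism R -> R}) (delta : R -> R) : Prop :=
  (prime p /\ odd p) /\
  (* R is a DVR with uniformizer p *)
  (p%:R != 0 :> R /\ p%:R \notin @GRing.unit R /\
   forall x : R, x != 0 ->
     exists (u : R) (k : nat), u \is a GRing.unit /\ x = u * p%:R ^+ k) /\
  (forall s : nat -> R, (forall k, dvdr (p%:R ^+ k) (s k.+1 - s k)) ->
     exists y : R, forall k, dvdr (p%:R ^+ k) (y - s k)) /\
  (* the residue field R/pR is algebraically closed ... *)
  (forall P : {poly R}, P \is monic -> (1 < size P)%N ->
     exists a : R, dvdr p%:R P.[a]) /\
  (* ... and algebraic over F_p, i.e. R/pR is the algebraic closure of F_p *)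
  (forall x : R, exists k : nat, (0 < k)%N /\ dvdr p%:R (x ^+ (p ^ k) - x)) /\
  (forall x : R, dvdr p%:R (phi x - x ^+ p)) /\
  (forall x : R, p%:R * delta x = phi x - x ^+ p).

Definition monom (V : finType) := {ffun V -> nat}.

(** A family of coefficients c defines a restricted power series
    (element of R[x_v : v in V]^, the p-adic completion of the polynomial
    ring): coefficients tend to 0 p-adically. *)
Definition restricted (R : comNzRingType) (p : nat) (V : finType)
    (c : monom V -> R) : Prop :=
  forall e : nat, exists S : seq (monom V),
    forall al, al \notin S -> dvdr (p%:R ^+ e) (c al).

(** The restricted power series with coefficients c evaluates to y at
    the point a (p-adic limit of the partial sums). *)
Definition rps_eval (R : comNzRingType) (p : nat) (V : finType)
    (c : monom V -> R) (a : V -> R) (y : R) : Prop :=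
  forall e : nat, exists S : seq (monom V),
    [/\ uniq S,
        (forall al, al \notin S -> dvdr (p%:R ^+ e) (c al)) &
        dvdr (p%:R ^+ e)
          (y - \sum_(al <- S) c al * \prod_(v : V) a v ^+ al v)].

Definition coordsGL (R : comUnitRingType) (delta : R -> R) (n m : nat)
    (g : 'M[R]_n) (v : option ('I_m.+1 * 'I_n * 'I_n)) : R :=
  match v with
  | None => (\det g)^-1
  | Some (j, a, b) => iter j delta (g a b)
  end.

(** f : GL_n(R) -> gl_n(R) is a delta-map: each entry is given by a
    restricted power series in R[x, det(x)^{-1}, x', ..., x^(m)]^
    (presented as R[x, y, x', ..., x^(m)]^ with y evaluated at det(x)^{-1}). *)
Definition delta_map_GL (R : comUnitRingType) (p : nat) (delta : R -> R)
    (n : nat) (f : 'M[R]_n -> 'M[R]_n) : Prop :=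
  exists m : nat, exists c : 'I_n -> 'I_n -> monom (option ('I_m.+1 * 'I_n * 'I_n)) -> R,
    (forall i j, restricted p (c i j)) /\
    (forall g : 'M[R]_n, g \in unitmx -> forall i j,
        rps_eval p (c i j) (coordsGL delta g) (f g i j)).

Definition coordsGm (R : comUnitRingType) (delta : R -> R) (m : nat)
    (u : R) (v : option 'I_m.+1) : R :=
  match v with
  | None => u^-1
  | Some j => iter j delta u
  end.

Definition delta_map_Gm (R : comUnitRingType) (p : nat) (delta : R -> R)
    (omega : R -> R) : Prop :=
  exists m : nat, exists c : monom (option 'I_m.+1) -> R,
    restricted p c /\
    (forall u : R, u \is a GRing.unit ->
        rps_eval p c (@coordsGm R delta m u) (omega u)).

(* Main.v *)
Require Import Defs.
From HB Require Import structures.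
From mathcomp Require Import all_boot all_order all_algebra ring.
Import GRing.Theory.
Local Open Scope ring_scope.
Set Implicit Arguments. Unset Strict Implicit. Unset Printing Implicit Defensive.

(* Let T be the torus of diagonal matrices with Teichmuller entries, on which phi is z |-> z^p and
   hence delta^k (z a) = z^(p^k) delta^k a.  A coboundary makes the value of f at one regular element
   of T diagonal; f then takes diagonal values on all diagonal matrices and vanishes on T.  The cocycle
   relation makes each entry of z |-> f (1 + z a E_ij) homogeneous in z, of degree 1 at (i, j), -1 at
   (j, i) and 0 elsewhere (after a good choice of the element of T).  As it is also a restricted power
   series in z vanishing at 0, only the (i, j) entry survives, and it is b_ij a.  Subtracting the
   coboundary of diag(b_0j) gives b_0j = 0; then b_j0 = 0 because a Weyl element normalizes T, and
   b_ij = 0 for all i, j by commutators.  So f vanishes on the elementary matrices, is scalar on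
   diagonal ones, and the theorem follows since GL_n of a local ring is generated by elementary
   matrices and diag(1, ..., 1, u). *)

(** * Congruences and Teichmuller elements *)

Section Divisibility.
Variable R : comNzRingType.
Implicit Types a b c x y : R.

Lemma dvdr0 a : dvdr a 0.
Proof. by exists 0; rewrite mulr0. Qed.

Lemma dvdrr a : dvdr a a.
Proof. by exists 1; rewrite mulr1. Qed.

Lemma dvdrD a b c : dvdr a b -> dvdr a c -> dvdr a (b + c).
Proof. by move=> [r ->] [s ->]; exists (r + s); rewrite mulrDr. Qed.

Lemma dvdrB a b c : dvdr a b -> dvdr a c -> dvdr a (b - c).
Proof. by move=> [r ->] [s ->]; exists (r - s); rewrite mulrBr. Qed.

Lemma dvdr_mulr a b c : dvdr a b -> dvdr a (b * c).
Proof. by move=> [r ->]; exists (r * c); rewrite mulrA. Qed.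

Lemma dvdr_mull a b c : dvdr a b -> dvdr a (c * b).
Proof. by rewrite mulrC; apply: dvdr_mulr. Qed.

Lemma dvdr_mul a b c d : dvdr a b -> dvdr c d -> dvdr (a * c) (b * d).
Proof. by move=> [r ->] [s ->]; exists (r * s); rewrite mulrACA. Qed.

Lemma dvdr_trans a b c : dvdr a b -> dvdr b c -> dvdr a c.
Proof. by move=> [r ->] [s ->]; exists (r * s); rewrite mulrA. Qed.

Lemma dvdr_sum (I : Type) (s : seq I) (P : pred I) (F : I -> R) a :
  (forall i, P i -> dvdr a (F i)) -> dvdr a (\sum_(i <- s | P i) F i).
Proof. by move=> aF; apply: big_ind => //; [apply: dvdr0 | move=> *; apply: dvdrD]. Qed.

Lemma dvdr_exp a m n : (m <= n)%N -> dvdr (a ^+ m) (a ^+ n).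
Proof. by move=> mn; exists (a ^+ (n - m)); rewrite -exprD subnKC. Qed.

Lemma dvdr_subC a b c : dvdr a (b - c) -> dvdr a (c - b).
Proof. by move=> h; rewrite -[c - b]opprB -[- _]sub0r; apply: dvdrB => //; apply: dvdr0. Qed.

Lemma dvdr_sub_trans a y x z : dvdr a (x - y) -> dvdr a (y - z) -> dvdr a (x - z).
Proof. by move=> /dvdrD h /h; rewrite addrA subrK. Qed.

Lemma dvdr_subX a x y n : dvdr a (x - y) -> dvdr a (x ^+ n - y ^+ n).
Proof. by move=> xy; rewrite subrXX; apply: dvdr_mulr. Qed.

Lemma dvdr_sub_horner (P : {poly R}) x y : dvdr (x - y) (P.[x] - P.[y]).
Proof.
have : root (P - P.[y]%:P) y by rewrite rootE !hornerE subrr.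
case/factor_theorem=> q e; exists q.[x].
have := congr1 (horner^~ x) e.
by rewrite /= hornerM hornerD hornerN hornerC hornerXsubC => ->; rewrite mulrC.
Qed.

(** The cofactor of [x - y] in [x ^+ p - y ^+ p] is a sum of [p] terms, each congruent to
    [y ^+ p.-1] modulo [p], so it supplies one further factor [p]. *)
Lemma dvdr_subXp (p k : nat) x y : (0 < k)%N ->
  dvdr (p%:R ^+ k) (x - y) -> dvdr (p%:R ^+ k.+1) (x ^+ p - y ^+ p).
Proof.
move=> k0 xy; rewrite subrXX exprSr; apply: dvdr_mul => //.
have {k0}xy : dvdr p%:R (x - y).
  by apply: dvdr_trans xy; rewrite -{1}[p%:R]expr1; apply: dvdr_exp.
rewrite -[X in dvdr _ X](subrK (\sum_(i < p) y ^+ p.-1)).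
apply: dvdrD; last first.
  by rewrite sumr_const card_ord -[in X in dvdr _ X]mulr_natl; apply: dvdr_mulr; apply: dvdrr.
rewrite -sumrB; apply: dvdr_sum => i _.
have -> : y ^+ p.-1 = y ^+ (p.-1 - i) * y ^+ i.
  by rewrite -exprD subnK //; case: (p) i => [[]//|q i] /=; rewrite -ltnS.
by rewrite -mulrBl; apply: dvdr_mulr; apply: dvdr_subX.
Qed.

Lemma dvdr_subXpn (p m k : nat) x y : (0 < k)%N ->
  dvdr (p%:R ^+ k) (x - y) -> dvdr (p%:R ^+ (m + k)) (x ^+ (p ^ m) - y ^+ (p ^ m)).
Proof.
move=> k0 xy; elim: m => [|m IH]; first by rewrite expn0 !expr1.
by rewrite expnSr !exprM addSn; apply: dvdr_subXp => //; rewrite addn_gt0 k0 orbT.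
Qed.

End Divisibility.

(* A polynomial of degree < N that vanishes modulo [a] at [N] points whose differences are units
   vanishes modulo [a] everywhere, because these points are still distinct roots after division
   by a linear factor. *)
Lemma dvdr_horner_unit_roots (R : comUnitRingType) (a : R) (s : seq R) (P : {poly R}) :
  pairwise (fun x y => y - x \is a GRing.unit) s -> (size P <= size s)%N ->
  (forall x, x \in s -> dvdr a P.[x]) -> forall x, dvdr a P.[x].
Proof.
elim: s P => [|z s IH] P /=.
  by move=> _; rewrite leqn0 size_poly_eq0 => /eqP -> _ x; rewrite horner0; apply: dvdr0.
move=> /andP[/allP zs us] sP aP x.
have : root (P - P.[z]%:P) z by rewrite rootE !hornerE subrr.
case/factor_theorem=> q e.
have Pq y : P.[y] = q.[y] * (y - z) + P.[z].
  have := congr1 (horner^~ y) e.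
  rewrite /= hornerM hornerD hornerN hornerC hornerXsubC => <-.
  by rewrite subrK.
have aPz : dvdr a P.[z] by apply: aP; rewrite inE eqxx.
rewrite Pq; apply: dvdrD => //; apply: dvdr_mulr.
apply: (IH q us).
  have [->|q0] := eqVneq q 0; first by rewrite size_poly0.
  rewrite -ltnS; have <- : size (q * ('X - z%:P)) = (size q).+1.
    by rewrite size_Mmonic ?monicXsubC // size_XsubC addn2.
  rewrite -e; apply: leq_trans (size_polyD _ _) _.
  by rewrite geq_max sP size_polyN (leq_trans (size_polyC_leq1 _)).
move=> y ys.
have h : dvdr a (q.[y] * (y - z)).
  have := dvdrB (aP y (mem_behead (s := z :: s) ys)) aPz.
  by rewrite {1}Pq addrK.
by have := dvdr_mulr (y - z)^-1 h; rewrite mulrK // zs.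
Qed.

Section Teichmuller.
Variables (R : idomainType) (p : nat) (phi : {rmorphism R -> R}) (delta : R -> R).
Hypothesis Hset : delta_setting p phi delta.
Implicit Types x y z : R.

Lemma p_gt0 : (0 < p)%N.
Proof. by case: Hset => [[/prime_gt0]]. Qed.

Lemma unit_ndvdr x : x \is a GRing.unit -> ~ dvdr p%:R x.
Proof.
case: Hset => _ [[_ [pNU _]] _] xU [r e].
by move/negP: pNU; apply; move: xU; rewrite e unitrM => /andP[].
Qed.

Lemma nunit_dvdr x : x \isn't a GRing.unit -> dvdr p%:R x.
Proof.
case: Hset => _ [[_ [_ dvr]] _] xNU.
have [->|/dvr [u [[|k] [uU e]]]] := eqVneq x 0; first exact: dvdr0.
  by move: xNU; rewrite e mulr1 uU.
by rewrite e exprS mulrCA; apply: dvdr_mulr; apply: dvdrr.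
Qed.

(** Separatedness: a nonzero [x] is a unit times some [p ^ k], which [p ^ k.+1] does not divide.
    Equalities obtained by approximation rest on this. *)
Lemma eq0_dvdr_pX x : (forall k, dvdr (p%:R ^+ k) x) -> x = 0.
Proof.
case: (Hset) => _ [[p0 [pNU dvr]] _] px.
apply/eqP/negPn/negP => /dvr [u [k [uU e]]].
have [r er] := px k.+1.
apply: (unit_ndvdr uU); exists r.
have /mulIf : p%:R ^+ k != 0 :> R by rewrite expf_neq0.
by apply; rewrite -e er exprS mulrAC.
Qed.

Lemma unit_cong x y : dvdr p%:R (x - y) -> y \is a GRing.unit -> x \is a GRing.unit.
Proof.
move=> xy yU; apply/negPn/negP => /nunit_dvdr px; apply: (unit_ndvdr yU).
by rewrite -[y](subKr x); apply: dvdrB.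
Qed.

(** The Teichmuller representatives, 0 included: every residue lies in a finite field, so its
    multiplicative lift solves such an equation. *)
Definition teich z := exists2 k, (0 < k)%N & z ^+ (p ^ k) = z.

(** Raising to the power [p ^ (k * m)] fixes both elements but improves their congruence to one
    modulo [p ^ (k * m).+1]. *)
Lemma teich_inj k x y : (0 < k)%N ->
  x ^+ (p ^ k) = x -> y ^+ (p ^ k) = y -> dvdr p%:R (x - y) -> x = y.
Proof.
move=> k0 ex ey xy; apply/eqP; rewrite -subr_eq0; apply/eqP/eq0_dvdr_pX => m.
have it z : z ^+ (p ^ k) = z -> z ^+ (p ^ (k * m)) = z.
  by move=> e; elim: m => [|m IH]; rewrite ?muln0 // mulnS expnD exprM e.
rewrite -(it x) // -(it y) //.
apply: (dvdr_trans _ (dvdr_subXpn (p := p) (k := 1) (k * m) isT _)); last by rewrite expr1.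
by apply: dvdr_exp; rewrite addn1 (leq_trans (leq_pmull m k0)).
Qed.

(** Both sides solve the equation of [z] and agree modulo [p]. *)
Lemma teich_phi z : teich z -> phi z = z ^+ p.
Proof.
case=> k k0 e; apply: (teich_inj k0); first by rewrite -rmorphXn e.
  by rewrite exprAC e.
by case: Hset => _ [_ [_ [_ [_ [h _]]]]].
Qed.

(** The lift is the limit of the powers [x ^+ (p ^ (k * m))], where [k] is such that [x ^+ (p ^ k)]
    is congruent to [x]. *)
Lemma teich_lift x : exists2 z, teich z & dvdr p%:R (z - x).
Proof.
case: (Hset) => _ [_ [compl [_ [fin _]]]].
have [k [k0 xk]] := fin x.
pose s m := x ^+ (p ^ (k * m)).
have sS m : s m.+1 = s m ^+ (p ^ k) by rewrite /s mulnS addnC expnD exprM.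
have ss m : dvdr (p%:R ^+ m) (s m.+1 - s m).
  rewrite /s mulnS expnD exprM.
  apply: (dvdr_trans _ (dvdr_subXpn (p := p) (k := 1) (k * m) isT _)); last by rewrite expr1.
  by apply: dvdr_exp; rewrite addn1 (leq_trans (leq_pmull m k0)).
have [z zs] := compl _ ss.
exists z.
  exists k => //; apply/eqP; rewrite -subr_eq0; apply/eqP/eq0_dvdr_pX => m.
  apply: (dvdr_sub_trans (y := s m.+1)); first by rewrite sS; apply: dvdr_subX.
  by apply: dvdr_sub_trans (ss m) _; apply: dvdr_subC.
apply: (dvdr_sub_trans (y := s 1%N)); first by have := zs 1%N; rewrite expr1.
by rewrite /s muln1.
Qed.

Lemma teich0 : teich 0.
Proof. by exists 1%N => //; rewrite expr0n expn_eq0 (gtn_eqF p_gt0). Qed.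

(** If [z] lifts a root modulo [p] of [Q + 1], where [Q] is X times the product of the X - b, then
    [Q.[z]] is a unit; so [z] and all the z - b are units. *)
Lemma teich_unit_seq N : exists s : seq R,
  [/\ size s = N, forall z, z \in s -> teich z /\ z \is a GRing.unit &
      pairwise (fun x y => y - x \is a GRing.unit) s].
Proof.
elim: N => [|N [s [ss sT sU]]]; first by exists [::].
pose Q := \prod_(b <- s) ('X - b%:P) * 'X.
have szQ : size Q = (size s).+2 by rewrite size_mulX ?monic_neq0 ?monic_prod_XsubC // size_prod_XsubC.
have Q1 : Q + 1 \is monic.
  rewrite monicE lead_coefDl ?size_poly1 ?szQ //.
  by rewrite -monicE monicMl ?monic_prod_XsubC // monicX.
have szQ1 : (1 < size (Q + 1)%R)%N by rewrite size_polyDl ?szQ ?size_poly1.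
case: (Hset) => _ [_ [_ [closed _]]].
have [a Pa] := closed _ Q1 szQ1.
have [z zT za] := teich_lift a.
have : Q.[z] \is a GRing.unit.
  apply: (unit_cong (y := -1)); last by rewrite unitrN1.
  have -> : Q.[z] - -1 = (Q + 1).[z] by rewrite !hornerE opprK.
  rewrite -[_.[z]](subrK (Q + 1).[a]); apply: dvdrD => //.
  exact: dvdr_trans za (dvdr_sub_horner _ _ _).
rewrite /Q hornerM hornerX horner_prod unitrM => /andP[zsU zU].
exists (z :: s); split; rewrite /= ?ss //.
  by move=> y; rewrite inE => /orP[/eqP -> //|/sT].
rewrite sU andbT; apply/allP => b bs.
move: zsU; rewrite (big_rem b) //= unitrM hornerXsubC => /andP[h _].
by rewrite -opprB unitrN.
Qed.

Lemma delta0 : delta 0 = 0.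
Proof.
case: Hset => _ [[p0 _] [_ [_ [_ [_ h]]]]].
by apply: (mulfI p0); rewrite h mulr0 rmorph0 expr0n (gtn_eqF p_gt0) subr0.
Qed.

Lemma delta1 : delta 1 = 0.
Proof.
case: Hset => _ [[p0 _] [_ [_ [_ [_ h]]]]].
by apply: (mulfI p0); rewrite h mulr0 rmorph1 expr1n subrr.
Qed.

Lemma delta_teichM z x : teich z -> delta (z * x) = z ^+ p * delta x.
Proof.
case: (Hset) => _ [[p0 _] [_ [_ [_ [_ h]]]]] zT.
by apply: (mulfI p0); rewrite mulrCA !h rmorphM (teich_phi zT) exprMn mulrBr.
Qed.

Lemma teichX z n : teich z -> teich (z ^+ n).
Proof. by case=> k k0 e; exists k => //; rewrite exprAC e. Qed.

Lemma iter_delta_teichM k z x : teich z -> iter k delta (z * x) = z ^+ (p ^ k) * iter k delta x.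
Proof.
elim: k z x => [|k IH] z x zT; first by rewrite expr1.
by rewrite iterSr delta_teichM // IH ?iterSr -?exprM -?expnS //; apply: teichX.
Qed.

Lemma iter_delta0 k : iter k delta 0 = 0.
Proof. by elim: k => //= k ->; rewrite delta0. Qed.

Lemma iter_delta1 k : iter k delta 1 = (k == 0%N)%:R.
Proof. by case: k => // k; rewrite iterSr delta1 iter_delta0. Qed.

(* [x |-> b x - x * b 1] vanishes at Teichmuller elements, so its value at [x = z + p x'] is [p] times
   its value at [x']. *)
Lemma teich_linear (b : R -> R) :
  (forall x y, b (x + y) = b x + b y) -> (forall z x, teich z -> b (z * x) = z * b x) ->
  forall x, b x = x * b 1.
Proof.
move=> bD bZ x; apply/eqP; rewrite -subr_eq0; apply/eqP/eq0_dvdr_pX => k.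
have b0 : b 0 = 0 by have := bD 0 0; rewrite addr0 => /(congr1 (+%R^~ (- b 0))); rewrite addrK subrr.
have bn m y : b (m%:R * y) = m%:R * b y.
  by elim: m => [|m IH]; rewrite ?mul0r // -add1n natrD !mulrDl !mul1r bD IH.
elim: k x => [|k IH] x; first by exists (b x - x * b 1); rewrite mul1r.
have [z zT /dvdr_subC [y e]] := teich_lift x.
have -> : x = z * 1 + p%:R * y by rewrite -e mulr1 addrC subrK.
rewrite bD bZ // bn mulr1 mulrDl opprD addrACA subrr add0r -mulrA -mulrBr exprS.
by apply: dvdr_mul => //; apply: dvdrr.
Qed.

End Teichmuller.

(** * Elementary matrices over a local ring *)

Section Elementary.
Variable R : comUnitRingType.

(** The case [i = j] is used too: [elem_mx k k (u - 1)] is diagonal, with [u] at place [k] and 1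
    elsewhere. *)
Definition elem_mx n (i j : 'I_n) (a : R) : 'M[R]_n := 1%:M + a *: delta_mx i j.

Lemma elem_mxE n (i j : 'I_n) (a : R) k l :
  elem_mx i j a k l = (k == l)%:R + a * ((k == i) && (l == j))%:R.
Proof. by rewrite !mxE. Qed.

Lemma elem_mx0 n (i j : 'I_n) : elem_mx i j 0 = 1%:M.
Proof. by rewrite /elem_mx scale0r addr0. Qed.

Lemma elem_mxD n (i j : 'I_n) a b : i != j ->
  elem_mx i j a *m elem_mx i j b = elem_mx i j (a + b).
Proof.
move=> ij; rewrite /elem_mx mulmxDl mul1mx mulmxDr mulmx1 -scalemxAl -scalemxAr.
by rewrite mul_delta_mx_0 1?eq_sym // !scaler0 addr0 -addrA scalerDl [b *: _ + _]addrC.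
Qed.

Lemma elem_mxK n (i j : 'I_n) a (g : 'M_n) : i != j -> elem_mx i j (- a) *m (elem_mx i j a *m g) = g.
Proof. by move=> ij; rewrite mulmxA elem_mxD // addNr elem_mx0 mul1mx. Qed.

Lemma elem_mx_unit n (i j : 'I_n) a : i != j -> elem_mx i j a \in unitmx.
Proof.
move=> ij; have /mulmx1_unit[//] : elem_mx i j a *m elem_mx i j (- a) = 1%:M.
by rewrite elem_mxD // subrr elem_mx0.
Qed.

Lemma mul_elem_mxE n (i j : 'I_n) a (g : 'M_n) k l :
  (elem_mx i j a *m g) k l = g k l + a * (k == i)%:R * g j l.
Proof.
rewrite /elem_mx mulmxDl mul1mx -scalemxAl !mxE -mulrA; congr (_ + _ * _).
rewrite (bigD1 j) //= big1 ?addr0 => [|m mj]; rewrite mxE ?eqxx ?andbT //.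
by rewrite (negPf mj) andbF mul0r.
Qed.

Let eq_shift := (eq_lshift, eq_rshift, eq_lrshift, eq_rlshift).
Let block_mxEE := (block_mxEul, block_mxEur, block_mxEdl, block_mxEdr).

Lemma block_elem_mx n (i j : 'I_n) a :
  block_mx 1%:M 0 0 (elem_mx i j a) = elem_mx (rshift 1 i) (rshift 1 j) a.
Proof.
apply/matrixP => k l; rewrite -[k]splitK -[l]splitK.
by case: (split k) => k'; case: (split l) => l' /=;
  rewrite block_mxEE !elem_mxE ?mxE !eq_shift /= ?andbF ?mulr0 ?addr0.
Qed.

Lemma block_col_elem_mx n (i : 'I_n) a :
  block_mx 1%:M 0 (a *: delta_mx i 0) 1%:M = elem_mx (rshift 1 i) (lshift n 0) a.
Proof.
apply/matrixP => k l; rewrite -[k]splitK -[l]splitK.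
by case: (split k) => k'; case: (split l) => l' /=;
  rewrite block_mxEE !elem_mxE ?mxE !eq_shift /= ?andbF ?mulr0 ?addr0 ?add0r.
Qed.

Lemma block_row_elem_mx n (i : 'I_n) a :
  block_mx 1%:M (a *: delta_mx 0 i) 0 1%:M = elem_mx (lshift n 0) (rshift 1 i) a.
Proof.
apply/matrixP => k l; rewrite -[k]splitK -[l]splitK.
by case: (split k) => k'; case: (split l) => l' /=;
  rewrite block_mxEE !elem_mxE ?mxE !eq_shift /= ?andbF ?mulr0 ?addr0 ?add0r.
Qed.

Hypothesis local : forall x y : R, x + y \is a GRing.unit ->
  (x \is a GRing.unit) || (y \is a GRing.unit).

(** In the expansion of the determinant along column [j], a sum of nonunits would be a nonunit by
    locality. *)
Lemma unitmx_col_unit n (g : 'M[R]_n.+1) j : g \in unitmx -> exists i, g i j \is a GRing.unit.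
Proof.
rewrite unitmxE (expand_det_col _ j) => gU.
case: (pickP (fun i => g i j \is a GRing.unit)) => [i iU|none]; first by exists i.
have : \sum_i g i j * cofactor g i j \isn't a GRing.unit; last by rewrite gU.
apply: (big_ind (fun x => x \isn't a GRing.unit)) => [|x y xN yN|i _]; first by rewrite unitr0.
  by apply/negP => /local; rewrite (negPf xN) (negPf yN).
by rewrite unitrM none.
Qed.

(* Over a local ring, elementary operations reduce an invertible matrix to diag(1, ..., 1, det). *)
Lemma GL_local_ind n (P : 'M[R]_n.+1 -> Prop) :
  (forall u, u \is a GRing.unit -> P (elem_mx ord_max ord_max (u - 1))) ->
  (forall i j a g, i != j -> P g -> P (elem_mx i j a *m g)) ->
  (forall i j a g, i != j -> P g -> P (g *m elem_mx i j a)) ->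
  forall g, g \in unitmx -> P g.
Proof.
elim: n P => [|n IH] P Pdiag Pl Pr g gU.
  have -> : g = elem_mx ord_max ord_max (g 0 0 - 1).
    apply/matrixP => i j; rewrite elem_mxE !ord1 -!(inj_eq val_inj) /=.
    by rewrite mulr1 addrC subrK.
  by apply: Pdiag; rewrite unitmxE det_mx11 in gU.
have Pl' i j a h : i != j -> P (elem_mx i j a *m h) -> P h.
  by move=> ij /(Pl i j (- a) _ ij); rewrite elem_mxK.
have step1 h : h \in unitmx -> h 0 0 = 1 -> P h.
  move=> hU h00; have e00 : ulsubmx (h : 'M_(1 + n.+1)) = 1%:M.
    apply/matrixP => i j; rewrite [i]ord1 [j]ord1 !mxE /= -[RHS]h00.
    by congr (h _ _); apply/val_inj.
  move: hU; rewrite -(submxK (h : 'M_(1 + n.+1))) e00.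
  set r := ursubmx _; set c := dlsubmx _; set d := drsubmx _ => hU.
  (* Block elimination: [d - c *m r] is the Schur complement of the corner 1. *)
  have e : block_mx 1%:M r c d = block_mx 1%:M 0 c 1%:M *m block_mx 1%:M 0 0 (d - c *m r)
      *m block_mx 1%:M r 0 1%:M.
    by rewrite !mulmx_block !(mul1mx, mulmx1, mulmx0, mul0mx, addr0, add0r) addrC subrK.
  (* Such a block matrix is a product of elementary ones, one for each entry of [c']. *)
  have PL c' : forall g' : 'M_(1 + n.+1), P g' -> P (block_mx 1%:M 0 c' 1%:M *m g').
    rewrite (matrix_sum_delta c').
    pose K (x : 'cV_n.+1) := forall g' : 'M_(1 + n.+1), P g' -> P (block_mx 1%:M 0 x 1%:M *m g').
    apply: (big_ind K) => [g' Pg'|x y Kx Ky g' Pg'|i _].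
    - by rewrite -(scalar_mx_block 1 n.+1) mul1mx.
    - have -> : block_mx 1%:M 0 (x + y) 1%:M =
          block_mx 1%:M 0 x 1%:M *m block_mx 1%:M 0 y 1%:M :> 'M_(1 + n.+1).
        by rewrite !mulmx_block !(mul1mx, mulmx1, mulmx0, mul0mx, addr0, add0r).
      by rewrite -mulmxA; apply/Kx/Ky.
    rewrite big_ord1 => g' Pg'; rewrite block_col_elem_mx.
    by apply: Pl => //; rewrite -(inj_eq val_inj).
  have PR c' : forall g' : 'M_(1 + n.+1), P g' -> P (g' *m block_mx 1%:M c' 0 1%:M).
    rewrite (matrix_sum_delta c') big_ord1.
    pose K (x : 'rV_n.+1) := forall g' : 'M_(1 + n.+1), P g' -> P (g' *m block_mx 1%:M x 0 1%:M).
    apply: (big_ind K) => [g' Pg'|x y Kx Ky g' Pg'|i _].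
    - by rewrite -(scalar_mx_block 1 n.+1) mulmx1.
    - have -> : block_mx 1%:M (x + y) 0 1%:M =
          block_mx 1%:M y 0 1%:M *m block_mx 1%:M x 0 1%:M :> 'M_(1 + n.+1).
        by rewrite !mulmx_block !(mul1mx, mulmx1, mulmx0, mul0mx, addr0, add0r).
      by rewrite mulmxA; apply/Kx/Ky.
    move=> g' Pg'; rewrite block_row_elem_mx.
    by apply: Pr => //; rewrite -(inj_eq val_inj).
  rewrite e; apply: PR; apply: PL.
  apply: (IH (fun h' => P (block_mx (1%:M : 'M_1) 0 0 h'))).
  - move=> u uU; rewrite block_elem_mx.
    have -> : rshift 1 ord_max = ord_max :> 'I_(1 + n.+1) by apply/val_inj.
    exact: Pdiag.
  - move=> i j a h' ij Ph'.
    have -> : block_mx 1%:M 0 0 (elem_mx i j a *m h') =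
        block_mx 1%:M 0 0 (elem_mx i j a) *m block_mx 1%:M 0 0 h' :> 'M_(1 + n.+1).
      by rewrite !mulmx_block !(mul1mx, mulmx1, mulmx0, mul0mx, addr0, add0r).
    by rewrite block_elem_mx; apply: Pl => //; rewrite (inj_eq (@rshift_inj _ _)).
  - move=> i j a h' ij Ph'.
    have -> : block_mx 1%:M 0 0 (h' *m elem_mx i j a) =
        block_mx 1%:M 0 0 h' *m block_mx 1%:M 0 0 (elem_mx i j a) :> 'M_(1 + n.+1).
      by rewrite !mulmx_block !(mul1mx, mulmx1, mulmx0, mul0mx, addr0, add0r).
    by rewrite block_elem_mx; apply: Pr => //; rewrite (inj_eq (@rshift_inj _ _)).
  move: hU; rewrite e !unitmx_mul => /andP[/andP[_]].
  by rewrite !unitmxE (det_lblock (1%:M : 'M_1)) det1 mul1r.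
(* A unit below the corner allows a row operation that turns the corner into 1. *)
have step2 h i : i != 0 -> h \in unitmx -> h i 0 \is a GRing.unit -> P h.
  move=> i0 hU iU; apply: (Pl' 0 i ((1 - h 0 0) / h i 0)); first by rewrite eq_sym.
  apply: step1; first by rewrite unitmx_mul elem_mx_unit // eq_sym.
  by rewrite mul_elem_mxE eqxx mulr1 divrK // addrC subrK.
have [i iU] := unitmx_col_unit 0 gU.
have [i0|i0] := eqVneq i 0; last exact: step2 i0 gU iU.
(* When the unit is the corner itself, a row operation first puts 1 at the bottom of column 0. *)
rewrite i0 in iU; apply: (Pl' ord_max 0 ((1 - g ord_max 0) / g 0 0)) => //.
apply: (step2 _ ord_max) => //; first by rewrite unitmx_mul elem_mx_unit.
by rewrite mul_elem_mxE eqxx mulr1 divrK // addrC subrK unitr1.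
Qed.

End Elementary.

(** * Restricted power series *)

Section PowerSeries.
Variables (R : comNzRingType) (p : nat).

(** Common indices cancel, and each remaining one lies outside one of the two lists. Hence partial
    sums of a series do not depend, modulo [a], on the list chosen. *)
Lemma dvdr_sum_sub (T : eqType) (F : T -> R) a (s t : seq T) : uniq s -> uniq t ->
  (forall x, x \notin s -> dvdr a (F x)) -> (forall x, x \notin t -> dvdr a (F x)) ->
  dvdr a (\sum_(x <- s) F x - \sum_(x <- t) F x).
Proof.
move=> us ut sF tF.
rewrite (bigID (mem t)) [X in _ - X](bigID (mem s)) /=.
have -> : \sum_(x <- s | x \in t) F x = \sum_(x <- t | x \in s) F x.
  rewrite -[LHS]big_filter -[RHS]big_filter; apply: perm_big.
  by apply: uniq_perm; rewrite ?filter_uniq // => x; rewrite !mem_filter andbC.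
rewrite opprD addrACA subrr add0r.
by apply: dvdrB; apply: dvdr_sum => x; [apply: tF | apply: sF].
Qed.

Variables (V : finType) (c : monom V -> R).

Lemma rps_eval_sum a y e (s : seq (monom V)) : rps_eval p c a y -> uniq s ->
  (forall al, al \notin s -> dvdr (p%:R ^+ e) (c al)) ->
  dvdr (p%:R ^+ e) (y - \sum_(al <- s) c al * \prod_v a v ^+ al v).
Proof.
move=> /(_ e) [t [ut tc yt]] us sc; apply: dvdr_sub_trans yt _.
by apply: dvdr_sum_sub => // al; [move/tc|move/sc]; apply: dvdr_mulr.
Qed.

Lemma restricted_seq e : restricted p c ->
  exists2 s, uniq s & forall al, al \notin s -> dvdr (p%:R ^+ e) (c al).
Proof.
by move=> /(_ e) [s sc]; exists (undup s); rewrite ?undup_uniq // => al; rewrite mem_undup; apply: sc.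
Qed.

(** Modulo [p ^ e] a restricted series is a polynomial, and it stays one when polynomials in [z]
    replace its variables. *)
Lemma rps_eval_poly (Z : R -> Prop) (a : R -> V -> R) (P : V -> {poly R}) (F : R -> R) :
  restricted p c -> (forall z, Z z -> forall v, a z v = (P v).[z]) ->
  (forall z, Z z -> rps_eval p c (a z) (F z)) ->
  forall e, exists Q : {poly R}, forall z, Z z -> dvdr (p%:R ^+ e) (F z - Q.[z]).
Proof.
move=> cr aP cF e; have [s us sc] := restricted_seq e cr.
exists (\sum_(al <- s) (c al)%:P * \prod_v P v ^+ al v) => z Zz.
rewrite horner_sum; under [X in _ - X]eq_bigr do
  [rewrite hornerM hornerC horner_prod; under eq_bigr do rewrite horner_exp -aP //].
exact: rps_eval_sum (cF z Zz) us sc.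
Qed.

(* Each variable is replaced by 0 or by a nonconstant monomial, so that only finitely many monomials
   are sent to a given one and the new coefficients are finite sums. *)
Lemma rps_subst (W : finType) (kill : pred V) (M : V -> W -> nat) :
  (forall v, ~~ kill v -> exists w, (0 < M v w)%N) -> restricted p c ->
  exists2 c' : monom W -> R, restricted p c' & forall a b y,
    (forall v, a v = if kill v then 0 else \prod_w b w ^+ M v w) ->
    rps_eval p c a y -> rps_eval p c' b y.
Proof.
move=> M0 cr.
(* [sg al] is the exponent of the image of the monomial [al]; [K al] says that no killed variable
   occurs in [al]. *)
pose sg (al : monom V) : monom W := [ffun w => \sum_v al v * M v w]%N.
pose K (al : monom V) := [forall v, kill v ==> (al v == 0%N)].
(* Each surviving variable has an image of positive degree, so the degree of [be] bounds all
   exponents in its fibre. *)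
pose B (be : monom W) := (\sum_w be w)%N.
pose fib (be : monom W) : seq (monom V) :=
  [seq al <- [seq [ffun v => nat_of_ord (h v)] | h : {ffun V -> 'I_(B be).+1}]
  | K al && (sg al == be)].
have fib_uniq be : uniq (fib be).
  apply/filter_uniq; rewrite map_inj_uniq ?enum_uniq // => h1 h2 /ffunP e.
  by apply/ffunP => v; apply/val_inj; have := e v; rewrite !ffunE.
have fibP be al : (al \in fib be) = K al && (sg al == be).
  rewrite mem_filter; apply: andb_idr => /andP[Kal /eqP sal].
  have alB v : (al v < (B be).+1)%N.
    rewrite ltnS; have [kv|/M0 [w Mw]] := boolP (kill v).
      by have /forallP/(_ v) := Kal; rewrite kv => /eqP ->.
    rewrite /B (bigD1 w) //= -sal ffunE (bigD1 v) //= -addnA.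
    by apply: leq_trans (leq_addr _ _); rewrite leq_pmulr.
  apply/mapP; exists [ffun v => Ordinal (alB v)]; first by rewrite mem_enum.
  by apply/ffunP => v; rewrite !ffunE.
pose c' be := \sum_(al <- fib be) c al.
have c'dvd e (s : seq (monom V)) : (forall al, al \notin s -> dvdr (p%:R ^+ e) (c al)) ->
    forall be, be \notin undup [seq sg al | al <- s & K al] -> dvdr (p%:R ^+ e) (c' be).
  move=> sc be; rewrite mem_undup => bes; rewrite /c' big_seq; apply: dvdr_sum => al.
  rewrite fibP => /andP[Kal /eqP sal]; apply: sc; apply: contra bes => als.
  by rewrite -sal; apply: map_f; rewrite mem_filter Kal.
exists c'.
  move=> e; have [s _ sc] := restricted_seq e cr.
  by exists (undup [seq sg al | al <- s & K al]); apply: c'dvd.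
move=> a b y ab cy e.
have [s us sc] := restricted_seq e cr.
exists (undup [seq sg al | al <- s & K al]); split; [exact: undup_uniq | exact: c'dvd |].
have prodE (al : monom V) : \prod_v a v ^+ al v = if K al then \prod_w b w ^+ sg al w else 0.
  case: ifPn => [/forallP Kal|]; last first.
    rewrite negb_forall => /existsP[v]; rewrite negb_imply => /andP[kv al0].
    by rewrite (bigD1 v) //= ab kv expr0n (negPf al0) mul0r.
  under [RHS]eq_bigr do rewrite ffunE expr_sum.
  rewrite exchange_big; apply: eq_bigr => v _; rewrite ab.
  have := Kal v; case: ifP => _ /= => [/eqP ->|_].
    by rewrite expr0 big1 // => w _; rewrite mul0n expr0.
  by rewrite -prodrXl; apply: eq_bigr => w _; rewrite -exprM mulnC.
apply: dvdr_sub_trans (rps_eval_sum cy us sc) _.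
(* The partial sum is regrouped by image monomial. What it lacks of a fibre lies outside [s] and is
   divisible by [p ^ e]. *)
have -> : \sum_(al <- s) c al * \prod_v a v ^+ al v =
    \sum_(be <- undup [seq sg al | al <- s & K al])
      (\sum_(al <- s | K al && (sg al == be)) c al) * \prod_w b w ^+ be w.
  under eq_bigr do rewrite prodE.
  under [RHS]eq_bigr do rewrite mulr_suml.
  under [RHS]eq_bigr do rewrite big_mkcond.
  rewrite [RHS]exchange_big /= big_seq [RHS]big_seq; apply: eq_bigr => al als.
  case: ifP => Kal /=; last by rewrite mulr0 big1_eq.
  rewrite (bigD1_seq (sg al)) ?undup_uniq //=; last first.
    by rewrite mem_undup; apply: map_f; rewrite mem_filter Kal.
  by rewrite eqxx [X in _ + X]big1 ?addr0 // => be; rewrite eq_sym => /negPf ->.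
rewrite -sumrB; apply: dvdr_sum => be _; rewrite -mulrBl; apply: dvdr_mulr.
rewrite -big_filter; set t := [seq al <- s | _]; rewrite /c'.
rewrite [X in _ - X](bigID (mem s)) /=.
have -> : \sum_(al <- fib be | al \in s) c al = \sum_(al <- t) c al.
  rewrite -[LHS]big_filter; apply: perm_big.
  apply: uniq_perm => [||al]; [exact: filter_uniq (fib_uniq be) | exact: filter_uniq |].
  by rewrite mem_filter fibP mem_filter andbC.
rewrite opprD addrA subrr add0r -sub0r; apply: dvdrB; first exact: dvdr0.
by apply: dvdr_sum => al; apply: sc.
Qed.

End PowerSeries.

(** * Cocycles for the adjoint action *)

Section Cocycle.
Variables (R : comUnitRingType) (n : nat).
Implicit Types (f : 'M[R]_n.+1 -> 'M[R]_n.+1) (g h t : 'M[R]_n.+1).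

Definition cocycle f := forall g h, g \in unitmx -> h \in unitmx ->
  f (g *m h) = f g + g *m f h *m invmx g.

Definition subcob f (v : 'M[R]_n.+1) g := f g - (g *m v *m invmx g - v).

(** Free of inverses, this form of the cocycle relation can be read entry by entry when [g] is
    diagonal. *)
Lemma cocycleM f g h : cocycle f -> g \in unitmx -> h \in unitmx ->
  f (g *m h) *m g = f g *m g + g *m f h.
Proof. by move=> cf gU hU; rewrite cf // mulmxDl mulmxKV. Qed.

Lemma subcobM f v g : g \in unitmx -> subcob f v g *m g = f g *m g - g *m v + v *m g.
Proof. by move=> gU; rewrite /subcob !mulmxBl mulmxKV // opprB addrA addrAC. Qed.

Lemma cocycle1 f : cocycle f -> f 1%:M = 0.
Proof.
move=> /(_ 1%:M 1%:M (unitmx1 _ _) (unitmx1 _ _)); rewrite invmx1 !mulmx1 mul1mx.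
by rewrite -[LHS]addr0 => /addrI.
Qed.

Lemma subcob_cocycle f v : cocycle f -> cocycle (subcob f v).
Proof.
move=> cf g h gU hU; rewrite /subcob cf //.
have -> : invmx (g *m h) = invmx h *m invmx g by exact: (@invrM _ g h gU hU).
rewrite mulmxBr mulmxBr !mulmxBl !mulmxA !opprB [RHS]addrACA; congr (_ + _).
by rewrite addrA subrK.
Qed.

Lemma cocycle_mull f g h : cocycle f -> g \in unitmx -> h \in unitmx ->
  f g = 0 -> f (g *m h) *m g = g *m f h.
Proof. by move=> cf gU hU g0; rewrite cocycleM // g0 mul0mx add0r. Qed.

Lemma cocycle_mulr f g h : cocycle f -> g \in unitmx -> h \in unitmx ->
  f h = 0 -> f (g *m h) = f g.
Proof. by move=> cf gU hU h0; rewrite cf // h0 mulmx0 mul0mx addr0. Qed.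

Lemma cocycle_mul0 f g h : cocycle f -> g \in unitmx -> h \in unitmx ->
  f g = 0 -> f h = 0 -> f (g *m h) = 0.
Proof. by move=> cf gU hU g0 h0; rewrite cocycle_mulr. Qed.

Lemma diag_unitmx (d : 'rV[R]_n.+1) : (forall i, d 0 i \is a GRing.unit) -> diag_mx d \in unitmx.
Proof.
move=> dU; rewrite unitmxE det_diag; apply: (big_ind (fun x => x \is a GRing.unit)) => //.
  exact: unitr1.
by move=> x y xU yU; rewrite unitrM xU.
Qed.

Lemma diag_elem_mx (d : 'rV[R]_n.+1) i j a c : d 0 i * a = c * d 0 j ->
  diag_mx d *m elem_mx i j a = elem_mx i j c *m diag_mx d.
Proof.
move=> e; apply/matrixP => k l; rewrite mul_diag_mx mul_mx_diag !mxE mulrDr mulrDl.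
congr (_ + _).
  by case: (eqVneq k l) => [->|_]; rewrite ?mulr1 ?mul1r ?mulr0 ?mul0r.
by case: (eqVneq k i) => [->|_]; case: (eqVneq l j) => [->|_]; rewrite /= ?mulr0 ?mul0r ?mulr1.
Qed.

Lemma invmx_elem (i j : 'I_n.+1) (a : R) : i != j -> invmx (elem_mx i j a) = elem_mx i j (- a).
Proof.
move=> ij; rewrite -[LHS]mulmx1 -(elem_mx0 R i j) -(subrr a) -elem_mxD // mulmxA.
by rewrite mulVmx ?mul1mx ?elem_mx_unit.
Qed.

Lemma det_elem_mx (i j : 'I_n.+1) (a : R) : i != j -> \det (elem_mx i j a) = 1.
Proof.
wlog ji : i j / (j < i)%N => [th|] ij.
  have [|ji] := ltnP j i; first by move/th; apply.
  rewrite -det_tr; have -> : (elem_mx i j a)^T = elem_mx j i a.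
    by rewrite /elem_mx raddfD /= tr_scalar_mx linearZ /= trmx_delta.
  by apply: th; rewrite 1?eq_sym // ltn_neqAle ji andbT.
rewrite det_trig; last first.
  apply/is_trig_mxP => k l kl; rewrite elem_mxE -val_eqE (ltn_eqF kl) add0r.
  case: (eqVneq k i) kl => [->|_]; case: (eqVneq l j) => [->|_] kl; rewrite /= ?mulr0 //.
  by rewrite ltnNge ltnW in kl.
rewrite big1 // => k _; rewrite elem_mxE eqxx.
by case: eqP => [->|_]; rewrite /= ?(negPf ij) ?mulr0 ?addr0.
Qed.

Lemma diag_elem_mxE (k : 'I_n.+1) (u : R) :
  elem_mx k k (u - 1) = diag_mx (\row_i if i == k then u else 1).
Proof.
apply/matrixP => i j; rewrite elem_mxE !mxE; case: (eqVneq i j) => [<-|ij].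
  by rewrite andbb; case: eqP => _; rewrite ?mulr0 ?addr0 // mulr1 addrC subrK.
rewrite add0r; case: (eqVneq i k) ij => [->|_]; rewrite /= ?mulr0 // eq_sym => /negPf ->.
by rewrite mulr0.
Qed.

Lemma det_diag_elem_mx (k : 'I_n.+1) (u : R) : \det (elem_mx k k (u - 1)) = u.
Proof.
rewrite diag_elem_mxE det_diag (bigD1 k) //= mxE eqxx big1 ?mulr1 // => i /negPf ik.
by rewrite mxE ik.
Qed.

End Cocycle.

(** * Cocycles adapted to the torus and their weights *)

Section AdaptedCocycles.
Variables (R : idomainType) (p : nat) (phi : {rmorphism R -> R}) (delta : R -> R).
Hypothesis Hset : delta_setting p phi delta.
Variable n : nat.
Implicit Types (f : 'M[R]_n.+1 -> 'M[R]_n.+1) (d : 'rV[R]_n.+1) (S : pred 'I_n.+1).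

Lemma setting_local x y : x + y \is a GRing.unit -> (x \is a GRing.unit) || (y \is a @GRing.unit R).
Proof.
move=> xyU; apply/negPn/negP; rewrite negb_or => /andP[/(nunit_dvdr Hset) px /(nunit_dvdr Hset) py].
by apply: (unit_ndvdr Hset xyU); apply: dvdrD.
Qed.

(* A restricted power series equal to [C / z ^+ m] at all Teichmuller units [z] equals it
   identically; evaluate at 0. *)
Lemma teich_weight_eq0 (F : R -> R) C m :
  (forall e, exists Q : {poly R}, forall z, teich p z -> dvdr (p%:R ^+ e) (F z - Q.[z])) ->
  F 0 = 0 -> (forall z, teich p z -> z \is a GRing.unit -> z ^+ m * F z = C) -> C = 0.
Proof.
move=> FQ F0 FC; apply: (eq0_dvdr_pX Hset) => e; have [Q QF] := FQ e.
(* [P] vanishes modulo [p ^ e] at Teichmuller units; [size P] of them with unit differences carry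
   this over to 0, where [Q] is congruent to [F 0 = 0]. *)
pose P := 'X^m * Q - C%:P.
have [s [ss sT sU]] := teich_unit_seq Hset (size P).
have PE z : P.[z] = z ^+ m * Q.[z] - C by rewrite !hornerE.
have : dvdr (p%:R ^+ e) P.[0].
  apply: (dvdr_horner_unit_roots sU); rewrite ?ss // => z /sT[zT zU].
  by rewrite PE -(FC z zT zU) -mulrBr; apply: dvdr_mull; apply: dvdr_subC; apply: QF.
have := QF 0 (teich0 Hset); rewrite F0 PE => Q0 PC.
rewrite -[C](subKr (0 ^+ m * Q.[0])); apply: dvdrB => //; apply: dvdr_mull.
by have := dvdrB (dvdr0 _) Q0; rewrite !sub0r opprK.
Qed.

(** Diagonal entries stay unconstrained, since they carry the future character [omega]. *)
Definition torus_adapted f := cocycle f /\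
  forall d, (forall i, d 0 i \is a GRing.unit) -> forall i j, i != j -> f (diag_mx d) i j = 0.

(* H^1 of a regular diagonal element [t] with values in the off-diagonal matrices vanishes, and
   everything commuting with [t] then has diagonal values. *)
Lemma torus_adapt f : cocycle f -> exists v, torus_adapted (subcob f v).
Proof.
move=> cf; have [s [ss sT sU]] := teich_unit_seq Hset n.+1.
pose t : 'rV[R]_n.+1 := \row_i s`_i.
have tU i : t 0 i \is a GRing.unit.
  by rewrite mxE; have [] := sT s`_i; rewrite ?mem_nth ?ss.
have tD i j : i != j -> t 0 i - t 0 j \is a GRing.unit.
  have sij (a b : 'I_n.+1) : (a < b)%N -> s`_b - s`_a \is a GRing.unit.
    by move=> ab; apply: (pairwiseP 0 sU); rewrite ?inE ?ss.
  rewrite !mxE -val_eqE neq_ltn => /orP[] /sij //.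
  by rewrite -opprB unitrN.
have tM := diag_unitmx tU.
(* This solves [v i j * (t i - t j) = f t i j * t j] off the diagonal. On the diagonal the inverse
   of 0 is 0, so the entry is 0. *)
pose v : 'M[R]_n.+1 := \matrix_(i, j) (f (diag_mx t) i j * t 0 j / (t 0 i - t 0 j)).
exists v; split; first exact: subcob_cocycle.
have ft i j : i != j -> subcob f v (diag_mx t) i j = 0.
  move=> ij; apply: (mulIr (tU j)); rewrite mul0r.
  have /matrixP/(_ i j) := subcobM f v tM.
  rewrite mul_mx_diag mxE => ->; rewrite !mul_mx_diag mul_diag_mx.
  move: (tD i j ij); rewrite !mxE => tijU.
  by rewrite -{1}[f _ _ _ * _](divrK tijU); ring.
move: (subcob f v) (subcob_cocycle v cf) ft => {cf v}f cf ft d dU i j ij.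
clearbody t.
have dM := diag_unitmx dU.
(* Comparing both expansions of [f] at this product gives [f d i j * (t i - t j) = 0]. *)
have dt : diag_mx d *m diag_mx t = diag_mx t *m diag_mx d by rewrite diag_mxC.
have /matrixP/(_ i j) := cocycleM cf dM tM; have /matrixP/(_ i j) := cocycleM cf tM dM.
rewrite dt; move: (f (diag_mx t *m diag_mx d)) => X.
rewrite !mul_mx_diag !mul_diag_mx !mxE ft // mulr0 mul0r addr0 add0r.
move=> e /(mulIr (dU j)) e'; apply: (mulIr (tD i j ij)).
by rewrite mul0r mulrBr [_ * t 0 i]mulrC -e e' subrr.
Qed.

(** Conjugation by it multiplies the entry (k, l) by z, 1 or 1/z, according to which of k and l lie
    in [S]; the choice of [S] selects the weights. *)
Definition teich_diag S z : 'M[R]_n.+1 := diag_mx (\row_i if S i then z else 1).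

Lemma teich_diag_unit S z : z \is a GRing.unit -> teich_diag S z \in unitmx.
Proof. by move=> zU; apply: diag_unitmx => i; rewrite mxE; case: ifP; rewrite ?unitr1. Qed.

(** The diagonal entries are additive in powers of [z], so [z ^+ (p ^ k) = z] makes [p ^ k - 1], a
    unit, annihilate them. *)
Lemma torus_adapted_teich f S z : torus_adapted f -> teich p z -> z \is a GRing.unit ->
  f (teich_diag S z) = 0.
Proof.
move=> [cf fd] [k k0 zk] zU; apply/matrixP => i j; rewrite [RHS]mxE.
have [<-{j}|ij] := eqVneq i j; last by apply: fd => // l; rewrite mxE; case: ifP; rewrite ?unitr1.
have fX m : f (teich_diag S (z ^+ m)) i i = m%:R * f (teich_diag S z) i i.
  elim: m => [|m IH].
    rewrite mul0r; have -> : teich_diag S (z ^+ 0) = 1%:M.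
      by apply/matrixP => a b; rewrite !mxE if_same.
    by rewrite cocycle1 // mxE.
  have -> : teich_diag S (z ^+ m.+1) = teich_diag S z *m teich_diag S (z ^+ m).
    rewrite /teich_diag mulmx_diag; congr diag_mx; apply/rowP => l; rewrite !mxE.
    by case: ifP => _; rewrite ?mul1r // exprS.
  have zM := teich_diag_unit S zU; have zmM := teich_diag_unit S (unitrX m zU).
  have /matrixP/(_ i i) := cocycleM cf zM zmM.
  move: (f (_ *m _)) (f (teich_diag S (z ^+ m))) (f (teich_diag S z)) IH => X Y T IH.
  rewrite /teich_diag !mul_mx_diag mul_diag_mx !mxE IH.
  rewrite ![_ * (if _ then _ else _)]mulrC -mulrDr => /mulrI ->; last first.
    by case: ifP; rewrite ?unitr1.
  by rewrite -[m.+1]add1n natrD mulrDl mul1r.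
have := fX (p ^ k)%N; rewrite zk => e.
have pU : (p ^ k)%:R - 1 \is a @GRing.unit R.
  apply: (unit_cong Hset (y := -1)); last exact: unitrN1.
  by rewrite opprK subrK natrX -(prednK k0) exprS; apply: dvdr_mulr; apply: dvdrr.
by apply: (mulrI pU); rewrite mulr0 mulrBl mul1r -e subrr.
Qed.

(** As [f] vanishes at the torus element t, its value at t g t^-1 is the conjugate by t of its value
    at g. *)
Lemma teich_diag_elem f S z i j a k l : torus_adapted f -> teich p z -> z \is a GRing.unit ->
  i != j -> S i -> ~~ S j ->
  f (elem_mx i j (z * a)) k l * (if S l then z else 1) =
  (if S k then z else 1) * f (elem_mx i j a) k l.
Proof.
move=> fa zT zU ij Si Sj; have cf := fa.1.
have t0 := torus_adapted_teich S fa zT zU; have tU := teich_diag_unit S zU.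
have e : teich_diag S z *m elem_mx i j a = elem_mx i j (z * a) *m teich_diag S z.
  by apply: diag_elem_mx; rewrite !mxE Si (negPf Sj) mulr1.
have /matrixP/(_ k l) := cocycle_mull cf tU (elem_mx_unit a ij) t0.
rewrite e (cocycle_mulr cf) ?elem_mx_unit // /teich_diag mul_mx_diag mul_diag_mx.
by rewrite !mxE.
Qed.

(** Polynomial approximation modulo each power of [p] is all that the weight argument takes from the
    power series, and it survives subtraction of a coboundary. *)
Definition teich_analytic f := forall i j a k l, i != j -> forall e, exists Q : {poly R},
  forall z, teich p z -> dvdr (p%:R ^+ e) (f (elem_mx i j (z * a)) k l - Q.[z]).

Lemma root_subgroup_value f i j : torus_adapted f -> teich_analytic f -> i != j ->
  exists b, forall a, f (elem_mx i j a) = (a * b) *: delta_mx i j.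
Proof.
move=> fa fan ij; have cf := fa.1.
have zero a k l m : (forall z, teich p z -> z \is a GRing.unit ->
    z ^+ m * f (elem_mx i j (z * a)) k l = f (elem_mx i j a) k l) -> f (elem_mx i j a) k l = 0.
  apply: (teich_weight_eq0 (F := fun z => f (elem_mx i j (z * a)) k l)); first exact: fan.
  by rewrite mul0r elem_mx0 cocycle1 // mxE.
have off a k l : (k, l) != (i, j) -> f (elem_mx i j a) k l = 0.
  move=> kl; have [ekl|kl'] := eqVneq (k, l) (j, i).
    (* Weight -1: the torus element has [z] at place [i] only. *)
    case: ekl => -> ->; apply: (zero _ _ _ 1%N) => z zT zU.
    have := @teich_diag_elem f (pred1 i) z i j a j i fa zT zU ij (eqxx i).
    by rewrite /= eq_sym (negPf ij) eqxx mul1r mulrC expr1; apply.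
  (* Weight 0: [S] must contain [i], avoid [j] and not separate [k] from [l]. This is possible
     because (k, l) is neither (i, j) nor (j, i). *)
  pose S := [pred x | (x == i) || ((k == i) || (l == i)) && ((x == k) || (x == l))].
  have Sj : ~~ S j.
    rewrite /= negb_or eq_sym ij /=; apply/negP => /andP[].
    move: kl kl'; rewrite !xpair_eqE !negb_and ![j == _]eq_sym => kl kl'.
    case/orP => /eqP ei; rewrite ei eqxx ?(negPf ij) ?orbF /= in kl kl' *.
      by rewrite (negPf kl).
    by rewrite ?orbF (negPf kl').
  have Si : S i by rewrite /= eqxx.
  have Skl : S k = S l.
    by rewrite /= !eqxx orbT /=; case: (k == i); case: (l == i).
  apply: (zero _ _ _ 0%N) => z zT zU; rewrite expr0 mul1r.
  have := teich_diag_elem a k l fa zT zU ij Si Sj.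
  by rewrite Skl mulrC => /mulrI; apply; case: ifP; rewrite ?unitr1.
pose b a := f (elem_mx i j a) i j.
have fb a : f (elem_mx i j a) = b a *: delta_mx i j.
  apply/matrixP => k l; rewrite !mxE -xpair_eqE.
  by case: eqP => [[-> ->]|/eqP kl]; rewrite ?mulr1 ?mulr0 // off.
have bD x y : b (x + y) = b x + b y.
  have := cocycleM cf (elem_mx_unit x ij) (elem_mx_unit y ij).
  rewrite elem_mxD // !fb /elem_mx !mulmxDl !mulmxDr !mulmx1 mul1mx -!scalemxAl -!scalemxAr.
  rewrite mul_delta_mx_0 1?eq_sym // !scaler0 !addr0 => /matrixP/(_ i j).
  by rewrite !mxE !eqxx !mulr1.
have bZ z x : teich p z -> b (z * x) = z * b x.
  move=> zT; have [zU|] := boolP (z \is a GRing.unit).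
    have := @teich_diag_elem f (pred1 i) z i j x i j fa zT zU ij (eqxx i).
    by rewrite /= eq_sym (negPf ij) eqxx mulr1; apply.
  (* A Teichmuller element that is not a unit is congruent to 0, hence equal to 0. *)
  case: zT => k k0 zk zN; suff -> : z = 0 by rewrite !mul0r /b elem_mx0 cocycle1 // mxE.
  apply: (teich_inj Hset k0 zk); last by rewrite subr0; apply: (nunit_dvdr Hset).
  by rewrite expr0n expn_eq0 (gtn_eqF (p_gt0 Hset)).
by exists (b 1) => a; rewrite fb (teich_linear Hset bD bZ a).
Qed.

End AdaptedCocycles.

(** * Vanishing on root subgroups and reduction to the determinant *)

Section RootSubgroups.
Variables (R : idomainType) (p : nat) (phi : {rmorphism R -> R}) (delta : R -> R).
Hypothesis Hset : delta_setting p phi delta.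
Variable n : nat.
Implicit Types (f : 'M[R]_n.+1 -> 'M[R]_n.+1) (d : 'rV[R]_n.+1) (S : pred 'I_n.+1).

(** All coordinates of 1 + z a E_ij are polynomials in [z]: the inverse determinant is 1, and the
    iterates of [delta] at [z * a] are monomials in [z]. *)
Lemma delta_map_teich_analytic f : delta_map_GL p delta f -> teich_analytic p f.
Proof.
move=> [m [c [cr cf]]] i j a k l ij.
pose P (v : option ('I_m.+1 * 'I_n.+1 * 'I_n.+1)) : {poly R} :=
  match v with
  | None => 1
  | Some (h, r, s) => if (r == i) && (s == j) then (iter h delta a)%:P * 'X^(p ^ h)
                      else (iter h delta (r == s)%:R)%:P
  end.
apply: (rps_eval_poly (Z := teich p) (a := fun z => coordsGL delta (elem_mx i j (z * a)))
  (P := P) (cr k l)); last by move=> z _; apply: cf; apply: elem_mx_unit.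
move=> z zT [[[h r] s]|] /=; last by rewrite det_elem_mx // invr1 hornerE.
rewrite elem_mxE; case: ifP => [/andP[/eqP -> /eqP ->]|rs].
  by rewrite (negPf ij) add0r mulr1 (iter_delta_teichM Hset) // !hornerE mulrC.
by rewrite mulr0 addr0 hornerE.
Qed.

(** With E = E_ij, the coboundary of [v] at 1 + x E is x (E v - v E) - x^2 E v E, a polynomial in
    x. *)
Lemma subcob_teich_analytic f v : teich_analytic p f -> teich_analytic p (subcob f v).
Proof.
move=> fan i j a k l ij e; have [Q fQ] := fan i j a k l ij e.
pose E : 'M[R]_n.+1 := delta_mx i j.
exists (Q - ((a * (E *m v - v *m E) k l)%:P * 'X - (a ^+ 2 * (E *m v *m E) k l)%:P * 'X^2)).
move=> z zT; rewrite /subcob !(hornerD, hornerN, hornerM, hornerC, hornerX, hornerXn) invmx_elem //.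
set x := f _; have -> : elem_mx i j (z * a) *m v *m elem_mx i j (- (z * a)) - v =
   (z * a) *: (E *m v - v *m E) - (z * a) ^+ 2 *: (E *m v *m E).
  rewrite /elem_mx -/E !mulmxDl !mulmxDr !mul1mx !mulmx1 -!scalemxAl -!scalemxAr.
  move: (E *m v *m E) (E *m v) (v *m E) => A B C.
  by apply/matrixP => r s; rewrite !mxE; ring.
have := fQ z zT.
rewrite /x !mxE => h.
congr (dvdr _ _): h; ring.
Qed.

Lemma subcob_diag_elem f d i j a : i != j ->
  subcob f (diag_mx d) (elem_mx i j a) =
  f (elem_mx i j a) - (a * (d 0 j - d 0 i)) *: delta_mx i j.
Proof.
move=> ij; rewrite /subcob invmx_elem //; congr (_ - _).
have dE : diag_mx d *m delta_mx i j = d 0 i *: delta_mx i j :> 'M[R]_n.+1.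
  apply/matrixP => k l; rewrite mul_diag_mx !mxE.
  by case: (eqVneq k i) => [->|_]; rewrite // !mulr0.
have Ed : delta_mx i j *m diag_mx d = d 0 j *: delta_mx i j :> 'M[R]_n.+1.
  apply/matrixP => k l; rewrite mul_mx_diag !mxE mulrC.
  by case: (eqVneq l j) => [->|_]; rewrite // andbF !mulr0.
rewrite /elem_mx !mulmxDl !mulmxDr !mul1mx !mulmx1 -!scalemxAl -!scalemxAr dE Ed.
rewrite -!scalemxAl mul_delta_mx_0 1?eq_sym //.
by apply/matrixP => k l; rewrite !mxE; ring.
Qed.

Lemma subcob_diag_diag f d (e : 'rV[R]_n.+1) : (forall i, e 0 i \is a GRing.unit) ->
  subcob f (diag_mx d) (diag_mx e) = f (diag_mx e).
Proof.
by move=> eU; rewrite /subcob diag_mxC mulmxK ?diag_unitmx // subrr subr0.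
Qed.

Lemma subcob_diag_adapted f d : torus_adapted f -> torus_adapted (subcob f (diag_mx d)).
Proof.
move=> [cf fd]; split; first exact: subcob_cocycle.
by move=> e eU i j ij; rewrite subcob_diag_diag // fd.
Qed.

(* [w = u u' u], with [u = 1 + E_ij] and [u' = 1 - E_ji], normalizes the torus, which makes [f w]
   vanish at (j, i); the cocycle relation computes this entry as [- b]. *)
Lemma opposite_root_eq0 f i j b : torus_adapted f -> i != j ->
  f (elem_mx i j 1) = 0 -> f (elem_mx j i (-1)) = b *: delta_mx j i -> b = 0.
Proof.
move=> fa ij fu fu'; have cf := fa.1; have ji : j != i by rewrite eq_sym.
set u := elem_mx i j 1 in fu; set u' := elem_mx j i (-1) in fu'.
have uU : u \in unitmx by apply: elem_mx_unit.
have u'U : u' \in unitmx by apply: elem_mx_unit.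
have wU : u *m (u' *m u) \in unitmx by rewrite !unitmx_mul uU u'U.
have fw : f (u *m (u' *m u)) j i = b.
  have := cocycle_mull (h := u' *m u) cf uU _ fu; rewrite unitmx_mul uU u'U => /(_ isT).
  rewrite (cocycle_mulr cf u'U uU fu) fu' => /matrixP/(_ j i).
  move: (f _) => X; rewrite /u /elem_mx mulmxDr mulmx1 mulmxDl mul1mx !scale1r -scalemxAr mul_delta_mx.
  rewrite !mxE !eqxx (negPf ji) /= big1 => [|k _]; last by rewrite mxE (negPf ij) andbF mulr0.
  by rewrite addr0 mulr0 addr0 mulr1.
(* [w] conjugates the torus element with [z] at [j] into the one with [z] at [i]. *)
have wt z : u *m (u' *m u) *m teich_diag (pred1 j) z = teich_diag (pred1 i) z *m (u *m (u' *m u)).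
  have tE k : teich_diag (pred1 k) z = 1%:M + (z - 1) *: delta_mx k k :> 'M[R]_n.+1.
    by rewrite -[RHS]/(elem_mx k k _) diag_elem_mxE.
  rewrite !tE mulmxDr mulmxDl mulmx1 mul1mx -scalemxAr -scalemxAl; congr (_ + _ *: _).
  rewrite /u /u' /elem_mx !scale1r scaleN1r.
  have zij (k l : 'I_n.+1) : delta_mx k i *m delta_mx j l = 0 :> 'M[R]_n.+1 by exact: mul_delta_mx_0.
  have zji (k l : 'I_n.+1) : delta_mx k j *m delta_mx i l = 0 :> 'M[R]_n.+1 by exact: mul_delta_mx_0.
  rewrite !(mulmxDl, mulmxDr, mulmxN, mulNmx, mulmx1, mul1mx, mulmx0, mul0mx, mul_delta_mx, zij, zji).
  by apply/matrixP => r s; rewrite !mxE; ring.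
have bz z : teich p z -> z \is a GRing.unit -> b * z = b.
  move=> zT zU.
  have ti := torus_adapted_teich Hset (pred1 i) fa zT zU.
  have tj := torus_adapted_teich Hset (pred1 j) fa zT zU.
  have := cocycle_mull cf (teich_diag_unit (pred1 i) zU) wU ti.
  rewrite -wt (cocycle_mulr cf wU (teich_diag_unit _ zU) tj) => /matrixP/(_ j i).
  by rewrite /teich_diag mul_mx_diag mul_diag_mx !mxE /= eqxx (negPf ji) fw mul1r.
(* Two Teichmuller units [x], [y] with unit difference give [b * x = b * y], so [b = 0]. *)
have [s [ss sT]] := teich_unit_seq Hset 2.
case: s ss sT => [|x [|y [|]]] //= _ sT /andP[/andP[xyU _] _].
have [xT xU] := sT x (mem_head _ _); have [yT yU] := sT y (mem_last x [:: y]).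
by apply: (mulIr xyU); rewrite mul0r mulrBr !bz // subrr.
Qed.

(** The Steinberg commutator relation, arranged to avoid inverses. *)
Lemma elem_mx_commutator (i j k : 'I_n.+1) (a : R) : i != j -> i != k -> k != j ->
  elem_mx i k a *m elem_mx k j 1 = elem_mx i j a *m (elem_mx k j 1 *m elem_mx i k a).
Proof.
move=> ij ik kj; rewrite /elem_mx !scale1r.
rewrite !(mulmxDl, mulmxDr, mulmx1, mul1mx) -!scalemxAl -!scalemxAr.
have [ji jk] : j != i /\ j != k by rewrite ![j == _]eq_sym.
rewrite mul_delta_mx !(mul_delta_mx_0 _ _ _ ji) (mul_delta_mx_0 _ _ _ jk) mulmx0.
by apply/matrixP => r s; rewrite !mxE /=; ring.
Qed.

(** Column 0 follows from row 0 by the Weyl element; all other root subgroups are reached by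
    commutators through the index 0. *)
Lemma root_subgroups_eq0 f : torus_adapted f ->
  (forall i j, i != j -> exists b, forall a, f (elem_mx i j a) = (a * b) *: delta_mx i j) ->
  (forall j a, 0 != j -> f (elem_mx 0 j a) = 0) ->
  forall i j a, i != j -> f (elem_mx i j a) = 0.
Proof.
move=> fa fb f0; have cf := fa.1.
have f0' i a : i != 0 -> f (elem_mx i 0 a) = 0.
  move=> i0; have [b fib] := fb i 0 i0; have i0' : 0 != i by rewrite eq_sym.
  have := opposite_root_eq0 fa i0' (f0 _ _ i0') (fib (-1)).
  by rewrite fib mulN1r => /eqP; rewrite oppr_eq0 => /eqP ->; rewrite mulr0 scale0r.
move=> i j a ij; have [i0|i0] := eqVneq i 0; first by move: ij; rewrite i0; apply: f0.
have [j0|j0] := eqVneq j 0; first by move: ij; rewrite j0; apply: f0'.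
have j0' : 0 != j by rewrite eq_sym.
have U1 := elem_mx_unit a i0; have U2 := elem_mx_unit (1 : R) j0'.
have fx : f (elem_mx 0 j 1 *m elem_mx i 0 a) = 0.
  by apply: (cocycle_mul0 cf) => //; [apply: f0 | apply: f0'].
rewrite -(cocycle_mulr cf (elem_mx_unit a ij) _ fx) ?unitmx_mul ?U1 ?U2 //.
rewrite -(elem_mx_commutator a ij i0 j0').
by apply: (cocycle_mul0 cf) => //; [apply: f0' | apply: f0].
Qed.

(** Moving an elementary matrix across [diag_mx d] shows that the value of [f] there commutes with
    [d 0 i] times E_(i,max), which equates diagonal entries i and max. *)
Lemma diag_scalar f d : torus_adapted f -> (forall i j a, i != j -> f (elem_mx i j a) = 0) ->
  (forall i, d 0 i \is a GRing.unit) -> f (diag_mx d) = (f (diag_mx d) ord_max ord_max)%:M.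
Proof.
move=> [cf fd] fe dU; have dM := diag_unitmx dU.
apply/matrixP => i j; rewrite mxE; have [<-{j}|ij] := eqVneq i j; last by rewrite fd.
rewrite mulr1n; have [->//|im] := eqVneq i ord_max.
have e : diag_mx d *m elem_mx i ord_max (d 0 ord_max) = elem_mx i ord_max (d 0 i) *m diag_mx d.
  by apply: diag_elem_mx.
have /matrixP/(_ i ord_max) := cocycle_mull cf (elem_mx_unit (d 0 i) im) dM (fe _ _ _ im).
rewrite -e (cocycle_mulr cf dM (elem_mx_unit _ im) (fe _ _ _ im)).
move: (f (diag_mx d)) (fd d dU i ord_max im) => X X0.
rewrite /elem_mx mulmxDl mulmxDr mul1mx mulmx1 -scalemxAl -scalemxAr mxE [RHS]mxE.
move=> /addrI; rewrite !mxE (bigD1 i) //= [X in _ + X]big1 ?addr0; last first.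
  by move=> k /negPf ki; rewrite mxE ki mulr0.
rewrite (bigD1 ord_max) //= [X in _ = _ * (_ + X)]big1 ?addr0; last first.
  by move=> k /negPf ki; rewrite mxE ki andbF mul0r.
by rewrite !mxE !eqxx mulr1 mul1r => /mulrI; apply.
Qed.

(** An elementary factor on the right leaves the value unchanged; one on the left conjugates it,
    without effect on a scalar. Neither changes the determinant. *)
Lemma cocycle_elem_invariant f : torus_adapted f ->
  (forall i j a, i != j -> f (elem_mx i j a) = 0) ->
  forall g, g \in unitmx ->
  f g = (f (elem_mx ord_max ord_max (\det g - 1)) ord_max ord_max)%:M.
Proof.
move=> fa fe; have cf := fa.1.
suff : forall g, g \in unitmx -> g \in unitmx /\
   f g = (f (elem_mx ord_max ord_max (\det g - 1)) ord_max ord_max)%:M.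
  by move=> h g /h [].
apply: (GL_local_ind (setting_local Hset)) => [u uU|i j a g ij [gU fg]|i j a g ij [gU fg]].
- rewrite unitmxE det_diag_elem_mx; split=> //.
  rewrite diag_elem_mxE; apply: diag_scalar => // i.
  by rewrite mxE; case: ifP; rewrite ?unitr1.
- have eU := elem_mx_unit a ij; rewrite unitmx_mul eU gU; split=> //.
  rewrite det_mulmx det_elem_mx // mul1r -[LHS](mulmxK eU).
  by rewrite (cocycle_mull cf eU gU (fe _ _ _ ij)) fg scalar_mxC mulmxK.
- have eU := elem_mx_unit a ij; rewrite unitmx_mul eU gU; split=> //.
  by rewrite det_mulmx det_elem_mx // mulr1 (cocycle_mulr cf gU eU (fe _ _ _ ij)).
Qed.

Lemma delta_map_corner f : delta_map_GL p delta f ->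
  delta_map_Gm p delta (fun u => f (elem_mx ord_max ord_max (u - 1)) ord_max ord_max).
Proof.
move=> [m [c [cr cf]]]; exists m.
(* The zero coordinates of diag(1, ..., 1, u): the off-diagonal ones, and positive iterates of
   [delta] at the entries 1. *)
pose kill (v : option ('I_m.+1 * 'I_n.+1 * 'I_n.+1)) :=
  if v is Some (h, r, s) then (r != s) || (r != ord_max) && (h != 0) else false.
(* The diagonal entries equal to 1 are rewritten as [u * u^-1]. *)
pose M (v : option ('I_m.+1 * 'I_n.+1 * 'I_n.+1)) (w : option 'I_m.+1) : nat :=
  match v, w with
  | None, None => 1
  | None, Some _ => 0
  | Some (h, r, s), None => (r != ord_max)
  | Some (h, r, s), Some h' => (h' == h)
  end.
have M0 v : ~~ kill v -> exists w, (0 < M v w)%N.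
  by case: v => [[[h r] s]|] _; [exists (Some h); rewrite /= eqxx | exists None].
have [c' c'r c'E] := rps_subst M0 (cr ord_max ord_max); exists c'; split=> // u uU.
have DU : elem_mx ord_max ord_max (u - 1) \in @unitmx R n.+1 by rewrite unitmxE det_diag_elem_mx.
apply: (c'E (coordsGL delta (elem_mx ord_max ord_max (u - 1)))); last exact: cf.
case=> [[[h r] s]|] /=; rewrite (bigD1 None) //=; last first.
  by rewrite det_diag_elem_mx big1 ?mulr1 // => -[h|] //= _; rewrite expr0.
rewrite (bigD1 (Some h)) //= eqxx [X in _ * (_ * X)]big1 ?mulr1; last first.
  by move=> -[h'|] //=; rewrite (inj_eq Some_inj) => /negPf ->.
rewrite diag_elem_mxE !mxE; have [->|rs] /= := eqVneq r s; last first.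
  by rewrite mulr0n (iter_delta0 Hset).
rewrite mulr1n; have [_|sm] := eqVneq s ord_max; first by rewrite /= expr0 mul1r expr1.
rewrite (iter_delta1 Hset) /= expr1 -[(h == 0%N :> nat)]/(h == 0).
by case: eqVneq => [->|_] //=; rewrite expr1 mulVr.
Qed.

End RootSubgroups.

(** * Decomposition of a cocycle into a scalar character and a coboundary *)

Theorem theorem1p3 (R : idomainType) (p : nat) (phi : {rmorphism R -> R})
    (delta : R -> R) (Hset : delta_setting p phi delta)
    (n : nat) (Hn : (0 < n)%N) (f : 'M[R]_n -> 'M[R]_n)
    (Hf : delta_map_GL p delta f)
    (Hcoc : forall g1 g2 : 'M[R]_n, g1 \in unitmx -> g2 \in unitmx ->
        f (g1 *m g2) = f g1 + g1 *m f g2 *m invmx g1) :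
  exists omega : R -> R,
    (forall u v : R, u \is a GRing.unit -> v \is a GRing.unit ->
        omega (u * v) = omega u + omega v) /\
    delta_map_Gm p delta omega /\
    exists v : 'M[R]_n, forall g : 'M[R]_n, g \in unitmx ->
      f g = (omega (\det g))%:M + g *m v *m invmx g - v.
Proof.
case: n Hn f Hf Hcoc => // n _ f Hf cf.
pose D u : 'M[R]_n.+1 := elem_mx ord_max ord_max (u - 1).
have [v1 f1a] := torus_adapt Hset cf; set f1 := subcob f v1 in f1a.
have f1b i j : i != j -> exists b, forall a, f1 (elem_mx i j a) = (a * b) *: delta_mx i j.
  move=> ij; apply: (root_subgroup_value Hset) => //.
  by apply: subcob_teich_analytic; apply: (delta_map_teich_analytic Hset).
(* The differences [d 0 j - d 0 0] are the coefficients of [f1] on row 0, so the coboundary of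
   [diag_mx d] cancels them. *)
pose d : 'rV[R]_n.+1 := \row_j if j == 0 then 0 else f1 (elem_mx 0 j 1) 0 j.
pose f2 := subcob f1 (diag_mx d).
have f2a : torus_adapted f2 by apply: subcob_diag_adapted.
have f2b i j : i != j -> exists b, forall a, f2 (elem_mx i j a) = (a * b) *: delta_mx i j.
  move=> ij; have [b fb] := f1b i j ij; exists (b - (d 0 j - d 0 i)) => a.
  by rewrite /f2 subcob_diag_elem // fb -scalerBl -mulrBr.
have f20 j a : 0 != j -> f2 (elem_mx 0 j a) = 0.
  move=> j0; rewrite /f2 subcob_diag_elem //; have [b fb] := f1b 0 j j0.
  have -> : d 0 j - d 0 0 = b.
    by rewrite [d 0 j]mxE [d 0 0]mxE eqxx [j == 0]eq_sym (negPf j0) fb mul1r !mxE !eqxx mulr1 subr0.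
  by rewrite fb subrr.
have f2E := cocycle_elem_invariant Hset f2a (root_subgroups_eq0 Hset f2a f2b f20).
(* Taken from [f], which is the map given by power series; [f2] agrees at this entry, since
   coboundaries have zero diagonal on diagonal matrices. *)
pose omega u := f (D u) ord_max ord_max.
have f2D u : u \is a GRing.unit -> f2 (D u) ord_max ord_max = omega u.
  move=> uU.
  have dU i : (\row_i (if i == ord_max then u else 1) : 'rV[R]_n.+1) 0 i \is a GRing.unit.
    by rewrite mxE; case: ifP; rewrite ?unitr1.
  rewrite /omega /D diag_elem_mxE /f2 subcob_diag_diag // /f1.
  have /matrixP/(_ ord_max ord_max) := subcobM f v1 (diag_unitmx dU).
  rewrite !mul_mx_diag mul_diag_mx !mxE eqxx [v1 _ _ * _]mulrC subrK.
  by apply: mulIr.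
have {}f2E g : g \in unitmx -> f2 g = (omega (\det g))%:M.
  by move=> gU; rewrite f2E // f2D.
exists omega; split=> [u v uU vU|]; last split.
- have DU w : w \is a GRing.unit -> D w \in unitmx by rewrite unitmxE det_diag_elem_mx.
  have [cf2 _] := f2a; have := cf2 _ _ (DU u uU) (DU v vU).
  rewrite !f2E ?unitmx_mul ?DU // det_mulmx !det_diag_elem_mx scalar_mxC mulmxK ?DU //.
  by move/matrixP/(_ 0 0); rewrite !mxE !mulr1n.
- exact: (delta_map_corner Hset).
exists (v1 + diag_mx d) => g gU; rewrite -f2E // /f2 /f1 /subcob.
rewrite mulmxDr mulmxDl; set x := _ *m _ *m _; set y := _ *m diag_mx d *m _.
by apply/matrixP => i j; rewrite !mxE; ring.
Qed.
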